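(* Let $\mathcal{V}$ be a variety of algebras such that there exists $\mathbf{A}\in\mathcal{V}$ for which $\operatorname{Con}(\mathbf{A})$ has a sublattice isomorphic to $\mathbf{M}_3$ all of whose congruences pairwise permute. Then $\mathbf{R}_n,\mathbf{S}_n\in\mathbf{Adm}(\mathcal{V})$ for all $n\ge 1$.
   Context: Algebras and varieties are in the sense of universal algebra; $\operatorname{Con}(\mathbf{A})$ is the congruence lattice of $\mathbf{A}$. Two congruences $\lambda,\mu$ permute if $\lambda\circ\mu=\mu\circ\lambda$. For a variety $\mathcal{V}$, $\mathbf{Adm}(\mathcal{V})$ is the class of all lattices $\mathbf{L}$ that are (up to isomorphism) sublattices of $\operatorname{Con}(\mathbf{A})$ for some $\mathbf{A}\in\mathcal{V}$. $\mathbf{M}_3$ is the five-element lattice with a bottom, a top and three pairwise incomparable atoms, any two distinct atoms meeting to the bottom and joining to the top. Let $(\mathbf{M}_3^i)_{i\ge1}$ be pairwise disjoint copies of $\mathbf{M}_3$, where $\mathbf{M}_3^i$ has bottom $\eta_i$, atoms $\alpha_i,\beta_i,\gamma_i$ and top $\delta_i$. Gluing a filter $\{u,v\}$ ($u<v$) of a lattice $\mathbf{P}$ to an ideal $\{u',v'\}$ ($u'<v'$) of a lattice $\mathbf{Q}$ means taking the disjoint union of $\mathbf{P}$ and $\mathbf{Q}$, identifying $u$ with $u'$ and $v$ with $v'$, and ordering the result by the transitive closure of the union of the two orders; the result is a lattice. The rods $\mathbf{R}_n$ and snakes $\mathbf{S}_n$ are defined by $\mathbf{R}_1=\mathbf{S}_1=\mathbf{M}_3^1$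 and, inductively: - $\mathbf{R}_{n+1}$ is obtained by gluing the filter $\{\gamma_n,\delta_n\}$ of $\mathbf{R}_n$ to the ideal $\{\eta_{n+1},\alpha_{n+1}\}$ of $\mathbf{M}_3^{n+1}$; - if $n$ is odd, $\mathbf{S}_{n+1}$ is obtained by gluing the filter $\{\gamma_n,\delta_n\}$ of $\mathbf{S}_n$ to the ideal $\{\eta_{n+1},\alpha_{n+1}\}$ of $\mathbf{M}_3^{n+1}$; if $n$ is even, $\mathbf{S}_{n+1}$ is obtained by gluing the filter $\{\alpha_n,\delta_n\}$ of $\mathbf{S}_n$ to the ideal $\{\eta_{n+1},\gamma_{n+1}\}$ of $\mathbf{M}_3^{n+1}$. *)

(* Defs.v *)
From HB Require Import structures.
From mathcomp Require Import all_boot all_order.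
From mathcomp Require Import boolp.

Set Implicit Arguments.
Unset Strict Implicit.
Unset Printing Implicit Defensive.

Import Order.TTheory.
Local Open Scope order_scope.

(** * Algebras and varieties *)

Record signature := Signature { symbol : Type; arity : symbol -> nat }.

Record algebra (sg : signature) := Algebra {
  carrier :> Type;
  carrier_nonempty : inhabited carrier;
  op : forall o : symbol sg, ('I_(arity o) -> carrier) -> carrier
}.

Inductive term (sg : signature) :=
| Var of nat
| App (o : symbol sg) of 'I_(arity o) -> term sg.

Fixpoint eval (sg : signature) (A : algebra sg) (e : nat -> A) (t : term sg) : A :=
  match t with
  | Var i => e i
  | App o ts => op (fun i => eval e (ts i))
  end.

Definition satisfies (sg : signature) (A : algebra sg) (s t : term sg) : Prop :=
  forall e : nat -> A, eval e s = eval e t.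

(* A variety is an equational class. *)
Definition variety (sg : signature) (V : algebra sg -> Prop) : Prop :=
  exists E : term sg -> term sg -> Prop,
  forall A, V A <-> (forall s t, E s t -> satisfies A s t).

(** * The congruence lattice *)

Record congruence (sg : signature) (A : algebra sg) := Congruence {
  con_rel :> A -> A -> Prop;
  con_refl : forall x, con_rel x x;
  con_sym : forall x y, con_rel x y -> con_rel y x;
  con_trans : forall x y z, con_rel x y -> con_rel y z -> con_rel x z;
  con_op : forall (o : symbol sg) (a b : 'I_(arity o) -> A),
    (forall i, con_rel (a i) (b i)) -> con_rel (op a) (op b)
}.

HB.instance Definition _ (sg : signature) (A : algebra sg) :=
  gen_eqMixin (congruence A).
HB.instance Definition _ (sg : signature) (A : algebra sg) :=
  gen_choiceMixin (congruence A).

Fact con_display : Order.disp_t. Proof. exact: Order.Disp tt tt. Qed.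

Section ConLattice.
Variables (sg : signature) (A : algebra sg).
Implicit Types r s t : congruence A.

Lemma con_ext r s : (forall x y, r x y <-> s x y) -> r = s.
Proof.
case: r s => [r r1 r2 r3 r4] [s s1 s2 s3 s4] /= rs.
have {}rs : r = s by apply/funext=> x; apply/funext=> y; apply/propext.
by case: _ / rs s1 s2 s3 s4 => *; congr Congruence; apply: Prop_irrelevance.
Qed.

Definition con_le r s : bool := `[< forall x y, r x y -> s x y >].

Lemma con_le_refl : reflexive con_le.
Proof. by move=> r; apply/asboolP. Qed.

Lemma con_le_anti : antisymmetric con_le.
Proof.
move=> r s /andP[/asboolP rs /asboolP sr].
by apply: con_ext => x y; split; [apply: rs | apply: sr].
Qed.

Lemma con_le_trans : transitive con_le.
Proof.
move=> s r t /asboolP rs /asboolP st.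
by apply/asboolP => x y /rs /st.
Qed.

HB.instance Definition _ := Order.Le_isPOrder.Build con_display (congruence A)
  con_le_refl con_le_anti con_le_trans.

Definition con_meet r s : congruence A.
Proof.
refine (@Congruence sg A (fun x y => r x y /\ s x y) _ _ _ _).
- by move=> x; split; apply: con_refl.
- by move=> x y [? ?]; split; apply: con_sym.
- by move=> x y z [? ?] [? ?]; split; apply: con_trans; eassumption.
- by move=> o a b ab; split; apply: con_op => i; case: (ab i).
Defined.

(* The join is the least congruence containing both arguments. *)
Definition con_join r s : congruence A.
Proof.
refine (@Congruence sg A (fun x y => forall t : congruence A,
  (forall u v, r u v -> t u v) -> (forall u v, s u v -> t u v) -> t x y) _ _ _ _).
- by move=> x t _ _; apply: con_refl.
- by move=> x y xy t rt st; apply: con_sym; apply: xy.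
- by move=> x y z xy yz t rt st; apply: con_trans (xy t rt st) (yz t rt st).
- by move=> o a b ab t rt st; apply: con_op => i; apply: ab.
Defined.

Lemma con_meetP r s t : (r <= con_meet s t) = (r <= s) && (r <= t).
Proof.
apply/asboolP/andP => [rst|[/asboolP rs /asboolP rt] x y rxy].
  by split; apply/asboolP => x y /rst[].
by split; [apply: rs | apply: rt].
Qed.

Lemma con_joinP r s t : (con_join r s <= t) = (r <= t) && (s <= t).
Proof.
apply/asboolP/andP => [rst|[/asboolP rt /asboolP st] x y xy].
  by split; apply/asboolP => x y xy; apply: rst => u ru su;
    [apply: ru | apply: su].
exact: xy.
Qed.

HB.instance Definition _ :=
  Order.POrder_MeetJoin_isLattice.Build con_display (congruence A)
    con_meetP con_joinP.

End ConLattice.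

Definition Con (sg : signature) (A : algebra sg) : latticeType con_display :=
  congruence A.

Definition rel_comp (T : Type) (r s : T -> T -> Prop) : T -> T -> Prop :=
  fun x z => exists2 y, r x y & s y z.

Definition permute (sg : signature) (A : algebra sg) (r s : Con A) : Prop :=
  rel_comp r s = rel_comp s r.

(* The image of an injective lattice morphism is a sublattice isomorphic to the
   source, so this says that L is isomorphic to a sublattice of some Con A. *)
Definition Adm (sg : signature) (V : algebra sg -> Prop)
    (d : Order.disp_t) (L : latticeType d) : Prop :=
  exists2 A : algebra sg, V A &
  exists f : {lmorphism L -> Con A}, injective f.

(** * The lattice M3 *)

Inductive M3 : predArgType := M3eta | M3alpha | M3beta | M3gamma | M3delta.

Definition M3_code (x : M3) : 'I_5 :=
  match x with
  | M3eta => inord 0 | M3alpha => inord 1 | M3beta => inord 2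
  | M3gamma => inord 3 | M3delta => inord 4
  end.

Definition M3_decode (i : 'I_5) : M3 :=
  nth M3eta [:: M3eta; M3alpha; M3beta; M3gamma; M3delta] i.

Lemma M3_codeK : cancel M3_code M3_decode.
Proof. by case; rewrite /M3_decode /= inordK. Qed.

HB.instance Definition _ := Finite.copy M3 (can_type M3_codeK).

Lemma M3_eqE (x y : M3) : (x == y) =
  match x, y with
  | M3eta, M3eta | M3alpha, M3alpha | M3beta, M3beta
  | M3gamma, M3gamma | M3delta, M3delta => true
  | _, _ => false
  end.
Proof. by apply/eqP; case: x; case: y. Qed.

Fact glue_display : Order.disp_t. Proof. exact: Order.Disp tt tt. Qed.

Definition M3_le (x y : M3) : bool := [|| x == y, x == M3eta | y == M3delta].

Definition M3_meet (x y : M3) : M3 :=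
  if M3_le x y then x else if M3_le y x then y else M3eta.

Definition M3_join (x y : M3) : M3 :=
  if M3_le x y then y else if M3_le y x then x else M3delta.

Lemma M3_le_refl : reflexive M3_le.
Proof. by case; rewrite /M3_le !M3_eqE. Qed.

Lemma M3_le_anti : antisymmetric M3_le.
Proof. by do 2!case; rewrite /M3_le !M3_eqE. Qed.

Lemma M3_le_trans : transitive M3_le.
Proof. by do 3!case; rewrite /M3_le !M3_eqE. Qed.

HB.instance Definition _ := Order.Le_isPOrder.Build glue_display M3
  M3_le_refl M3_le_anti M3_le_trans.

Lemma M3_leE (x y : M3) : (x <= y) = [|| x == y, x == M3eta | y == M3delta].
Proof. by []. Qed.

Lemma M3_meetP (x y z : M3) : (x <= M3_meet y z) = (x <= y) && (x <= z).
Proof.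
by case: x; case: y; case: z; rewrite /M3_meet /M3_le ?M3_eqE /= !M3_leE !M3_eqE.
Qed.

Lemma M3_joinP (x y z : M3) : (M3_join x y <= z) = (x <= z) && (y <= z).
Proof.
by case: x; case: y; case: z; rewrite /M3_join /M3_le ?M3_eqE /= !M3_leE !M3_eqE.
Qed.

HB.instance Definition _ :=
  Order.POrder_MeetJoin_isLattice.Build glue_display M3 M3_meetP M3_joinP.

Definition M3_atom (x : M3) : bool := (x != M3eta) && (x != M3delta).

(** * Gluing a two-element filter to a two-element ideal *)

Definition is_filter (d : Order.disp_t) (L : latticeType d) (F : {pred L}) : Prop :=
  [/\ exists x, x \in F,
      forall x y, x \in F -> x <= y -> y \in F &
      forall x y, x \in F -> y \in F -> x `&` y \in F].

Definition is_ideal (d : Order.disp_t) (L : latticeType d) (I : {pred L}) : Prop :=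
  [/\ exists x, x \in I,
      forall x y, y \in I -> x <= y -> x \in I &
      forall x y, x \in I -> y \in I -> x `|` y \in I].

Record filter2 (d : Order.disp_t) (L : latticeType d) := Filter2 {
  flo : L;
  fhi : L;
  flo_lt_fhi : flo < fhi;
  filter2P : is_filter (pred2 flo fhi)
}.

Record ideal2 (d : Order.disp_t) (L : latticeType d) := Ideal2 {
  ilo : L;
  ihi : L;
  ilo_lt_ihi : ilo < ihi;
  ideal2P : is_ideal (pred2 ilo ihi)
}.

(* The disjoint union of P and Q in which ilo I and ihi I are identified with
   flo F and fhi F is represented by omitting the elements of I from Q. *)
Definition glue (d d' : Order.disp_t) (P : finLatticeType d)
    (Q : finLatticeType d') (F : filter2 P) (I : ideal2 Q) : Type :=
  (P + {q : Q | q \notin pred2 (ilo I) (ihi I)})%type.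

Section Glue.
Variables (d d' : Order.disp_t) (P : finLatticeType d) (Q : finLatticeType d').
Variables (F : filter2 P) (I : ideal2 Q).

Local Notation G := (glue F I).

HB.instance Definition _ :=
  Finite.copy G (P + {q : Q | q \notin pred2 (ilo I) (ihi I)})%type.

Definition glueL (p : P) : G := inl p.

Definition glueR (q : Q) : G :=
  if insub q is Some q' then inr q'
  else if q == ilo I then inl (flo F) else inl (fhi F).

Definition glue_step (x y : G) : bool :=
  [exists p, exists p', [&& x == glueL p, y == glueL p' & p <= p']] ||
  [exists q, exists q', [&& x == glueR q, y == glueR q' & q <= q']].

(* Every element is related to itself by glue_step, so its reflexive transitive
   closure is its transitive closure. *)
Definition glue_le : rel G := connect glue_step.

Lemma le_fhi p : p <= fhi F.
Proof.
have [_ up _] := filter2P F.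
have: p `|` fhi F \in pred2 (flo F) (fhi F).
  by apply: (up (fhi F)); rewrite ?leUr // !inE eqxx orbT.
rewrite !inE => /orP[]/eqP E; last by rewrite -E leUl.
by have := lt_geF (flo_lt_fhi F); rewrite -E leUr.
Qed.

Lemma flo_le p : (flo F <= p) = (p \in pred2 (flo F) (fhi F)).
Proof.
have [_ up _] := filter2P F.
apply/idP/idP => [|]; first by apply: up; rewrite !inE eqxx.
by rewrite !inE => /orP[]/eqP-> //; exact: ltW (flo_lt_fhi F).
Qed.

Lemma ilo_le q : ilo I <= q.
Proof.
have [_ dn _] := ideal2P I.
have: q `&` ilo I \in pred2 (ilo I) (ihi I).
  by apply: (dn _ (ilo I)); rewrite ?leIr // !inE eqxx.
rewrite !inE => /orP[]/eqP E; first by rewrite -E leIl.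
by have := lt_geF (ilo_lt_ihi I); rewrite -E leIr.
Qed.

Lemma le_ihi q : (q <= ihi I) = (q \in pred2 (ilo I) (ihi I)).
Proof.
have [_ dn _] := ideal2P I.
apply/idP/idP => [|]; first by apply: dn; rewrite !inE eqxx orbT.
by rewrite !inE => /orP[]/eqP-> //; exact: ltW (ilo_lt_ihi I).
Qed.

Definition glue_leb (x y : G) : bool :=
  match x, y with
  | inl p, inl p' => p <= p'
  | inl p, inr q => (p <= flo F) || (ihi I <= val q)
  | inr q, inl p => false
  | inr q, inr q' => val q <= val q'
  end.
Arguments glue_leb !x !y /.

Lemma glueRP q :
  [\/ q = ilo I /\ glueR q = inl (flo F), q = ihi I /\ glueR q = inl (fhi F) |
      exists2 q' : {q : Q | q \notin pred2 (ilo I) (ihi I)},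
        val q' = q & glueR q = inr q'].
Proof.
rewrite /glueR; case: insubP => [q' _ <-|]; first by constructor 3; exists q'.
rewrite negbK !inE; case: eqP => [-> _|_ /= /eqP ->]; first by constructor 1.
by constructor 2.
Qed.

Lemma glueR_lo : glueR (ilo I) = inl (flo F).
Proof. by rewrite /glueR insubN ?eqxx // negbK !inE eqxx. Qed.

Lemma glueR_hi : glueR (ihi I) = inl (fhi F).
Proof.
by rewrite /glueR insubN ?negbK ?inE ?eqxx ?orbT // gt_eqF // ilo_lt_ihi.
Qed.

Lemma glueR_val (q : {q : Q | q \notin pred2 (ilo I) (ihi I)}) :
  glueR (val q) = inr q.
Proof. by rewrite /glueR valK. Qed.

Lemma val_le_ihi (q : {q : Q | q \notin pred2 (ilo I) (ihi I)}) :
  (val q <= ihi I) = false.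
Proof. by rewrite le_ihi; apply: negbTE (valP q). Qed.

Lemma glue_leb_L p p' : glue_leb (glueL p) (glueL p') = (p <= p').
Proof. by []. Qed.

Lemma glue_leb_R q q' : glue_leb (glueR q) (glueR q') = (q <= q').
Proof.
have ltF := flo_lt_fhi F; have ltI := ilo_lt_ihi I.
case: (glueRP q) => [[-> ->]|[-> ->]|[u <- ->]];
case: (glueRP q') => [[-> ->]|[-> ->]|[u' <- ->]] //=.
- by rewrite !lexx.
- by rewrite !ltW.
- by rewrite lexx ilo_le.
- by rewrite !lt_geF.
- by rewrite !lexx.
- by rewrite lt_geF.
- apply/esym/negbTE; apply/negP => h.
  by have := le_trans h (ilo_le (ihi I)); rewrite val_le_ihi.
- by rewrite val_le_ihi.
Qed.

Lemma glue_leb_refl : reflexive glue_leb.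
Proof. by case=> x /=. Qed.

Lemma glue_leb_trans : transitive glue_leb.
Proof.
case=> [y|y] [x|x] [z|z] //=.
- exact: le_trans.
- by move=> xy /orP[yF|->]; rewrite ?orbT // (le_trans xy yF).
- by move=> /orP[->//|yI] yz; rewrite (le_trans yI yz) orbT.
- exact: le_trans.
Qed.

Lemma glue_leE : glue_le =2 glue_leb.
Proof.
have stepL p p' : p <= p' -> glue_le (inl p) (inl p').
  move=> pp'; apply: connect1; apply/orP; left.
  by apply/existsP; exists p; apply/existsP; exists p'; rewrite !eqxx.
have stepR q q' : q <= q' -> glue_le (glueR q) (glueR q').
  move=> qq'; apply: connect1; apply/orP; right.
  by apply/existsP; exists q; apply/existsP; exists q'; rewrite !eqxx.
move=> x y; apply/idP/idP => [/connectP[s]|].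
  elim: s x => [|z s IHs] x /=; first by move=> _ ->; apply: glue_leb_refl.
  case/andP=> xz zs lst; apply: glue_leb_trans (IHs _ zs lst).
  case/orP: xz => /existsP[a /existsP[b /and3P[/eqP-> /eqP-> ab]]].
    by rewrite glue_leb_L.
  by rewrite glue_leb_R.
case: x y => [p|q] [p'|q'] //=; first exact: stepL.
- case/orP => [pF|Iq].
    apply: connect_trans (stepL _ _ pF) _.
    by rewrite -glueR_lo -glueR_val; apply: stepR; apply: ilo_le.
  apply: connect_trans (stepL _ _ (le_fhi p)) _.
  by rewrite -glueR_hi -glueR_val; apply: stepR.
- by move=> qq'; rewrite -!glueR_val; apply: stepR.
Qed.

Lemma glue_le_refl : reflexive glue_le.
Proof. by move=> x; apply: connect0. Qed.

Lemma glue_le_anti : antisymmetric glue_le.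
Proof.
move=> x y; rewrite !glue_leE.
case: x y => [p|q] [p'|q'] //=; rewrite ?andbF //.
  by move/le_anti->.
by move/le_anti/val_inj->.
Qed.

Lemma glue_le_trans : transitive glue_le.
Proof. by move=> y x z; apply: connect_trans. Qed.

HB.instance Definition _ := Order.Le_isPOrder.Build glue_display G
  glue_le_refl glue_le_anti glue_le_trans.

Definition glue_meet (x y : G) : G :=
  match x, y with
  | inl p, inl p' => inl (p `&` p')
  | inl p, inr q | inr q, inl p =>
      inl (if ihi I <= val q then p else p `&` flo F)
  | inr q, inr q' => glueR (val q `&` val q')
  end.

Definition glue_join (x y : G) : G :=
  match x, y with
  | inl p, inl p' => inl (p `|` p')
  | inl p, inr q | inr q, inl p =>
      glueR (if p <= flo F then val q else val q `|` ihi I)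
  | inr q, inr q' => glueR (val q `|` val q')
  end.

Lemma glue_leP (x y : G) : (x <= y) = glue_leb x y.
Proof. exact: glue_leE. Qed.

Lemma glue_leb_LR p q :
  glue_leb (inl p) (glueR q) = (p <= flo F) || (ihi I <= q).
Proof.
have ltI := ilo_lt_ihi I.
case: (glueRP q) => [[-> ->]|[-> ->]|[u <- ->]] //=.
- by rewrite (lt_geF ltI) orbF.
- by rewrite lexx orbT le_fhi.
Qed.

Lemma glue_meetP (x y z : G) : (x <= glue_meet y z) = (x <= y) && (x <= z).
Proof.
rewrite !glue_leP.
case: x y z => [x|x] [y|y] [z|z] //=.
- exact: lexI.
- case: ifP => _; first by rewrite orbT andbT.
  by rewrite orbF lexI.
- case: ifP => _; first by rewrite orbT.
  by rewrite orbF lexI andbC.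
- rewrite glue_leb_LR lexI.
  by case: (x <= flo F).
- by rewrite andbF.
- by rewrite -glueR_val glue_leb_R lexI.
Qed.

Lemma glue_joinP (x y z : G) : (glue_join x y <= z) = (x <= z) && (y <= z).
Proof.
have RLF q (u : {q : Q | q \notin pred2 (ilo I) (ihi I)}) p :
    val u <= q -> glue_leb (glueR q) (inl p) = false.
  move=> uq; apply/negbTE/negP; case: (glueRP q) => [[E _]|[E _]|[v _ ->]] //.
    by have := val_le_ihi u; rewrite (le_trans uq) // E ltW // ilo_lt_ihi.
  by have := val_le_ihi u; rewrite (le_trans uq) // E.
rewrite !glue_leP.
case: x y z => [x|x] [y|y] [z|z] //=.
- exact: leUx.
- rewrite leUx; case: (x <= flo F); case: (y <= flo F) => /=;
  by rewrite ?andbT ?andbb.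
- by rewrite andbF; apply: (RLF _ y); case: ifP; rewrite ?leUl.
- rewrite -[in LHS]glueR_val glue_leb_R.
  by case: ifP => _ //=; rewrite leUx andbC.
- by apply: (RLF _ x); case: ifP; rewrite ?leUl.
- rewrite -[in LHS]glueR_val glue_leb_R.
  by case: ifP => _ //=; rewrite ?andbT // leUx.
- by apply: (RLF _ x); rewrite leUl.
- by rewrite -[in LHS]glueR_val glue_leb_R leUx.
Qed.

HB.instance Definition _ :=
  Order.POrder_MeetJoin_isLattice.Build glue_display G glue_meetP glue_joinP.

Lemma leq_glueR q q' : (glueR q <= glueR q') = (q <= q').
Proof. by rewrite glue_leP glue_leb_R. Qed.

Lemma glueR_filter2 q q' : ilo I < q -> q < q' ->
  is_filter (pred2 q q') -> is_filter (pred2 (glueR q) (glueR q')).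
Proof.
move=> Iq qq' [_ up _].
have memR x : x \in pred2 q q' -> glueR x \in pred2 (glueR q) (glueR q').
  by rewrite !inE => /orP[]/eqP->; rewrite eqxx ?orbT.
have le2 x y : x \in pred2 (glueR q) (glueR q') -> x <= y -> glueR q <= y.
  rewrite !inE => /orP[]/eqP-> // q'y.
  by apply: le_trans q'y; rewrite leq_glueR ltW.
have upR y : glueR q <= y -> y \in pred2 (glueR q) (glueR q').
  case: y => [p|u] qy; last first.
    by move: qy; rewrite -glueR_val leq_glueR => /up h; apply/memR/h;
      rewrite !inE eqxx.
  case: (glueRP q) (qy) => [[E _]|[E Eq]|[u _ ->]]; last 1 first.
  - by rewrite glue_leP.
  - by move: Iq; rewrite E ltxx.
  rewrite Eq glue_leP /= => pp.
  apply/orP; left; apply/eqP; congr inl.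
  by apply: le_anti; rewrite pp andbT; apply: le_fhi.
split; first by exists (glueR q); rewrite !inE eqxx.
  by move=> x y xF /(le2 _ _ xF); apply: upR.
move=> x y xF yF; apply: upR.
by rewrite lexI (le2 _ _ xF (lexx _)) (le2 _ _ yF (lexx _)).
Qed.

End Glue.

(** * Rods and snakes *)

Lemma M3_atom_ideal (a : M3) : M3_atom a -> is_ideal (pred2 M3eta a).
Proof.
move=> aP; split.
- by exists a; rewrite !inE eqxx orbT.
- move=> x y; move: aP; rewrite /M3_atom !inE M3_leE !M3_eqE.
  by case: a; case: x; case: y.
- move=> x y; move: aP; rewrite -[x `|` y]/(M3_join x y) /M3_join.
  rewrite /M3_atom /M3_le !inE !M3_eqE.
  by case: a; case: x; case: y => //=; rewrite ?M3_eqE.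
Qed.

Lemma M3_atom_filter (a : M3) : M3_atom a -> is_filter (pred2 a M3delta).
Proof.
move=> aP; split.
- by exists a; rewrite !inE eqxx.
- move=> x y; move: aP; rewrite /M3_atom !inE M3_leE !M3_eqE.
  by case: a; case: x; case: y.
- move=> x y; move: aP; rewrite -[x `&` y]/(M3_meet x y) /M3_meet.
  rewrite /M3_atom /M3_le !inE !M3_eqE.
  by case: a; case: x; case: y => //=; rewrite ?M3_eqE.
Qed.

Lemma M3_eta_lt (a : M3) : M3_atom a -> M3eta < a.
Proof. by case: a; rewrite // /M3_atom lt_neqAle M3_leE !M3_eqE. Qed.

Lemma M3_lt_delta (a : M3) : M3_atom a -> a < M3delta.
Proof. by case: a; rewrite // /M3_atom lt_neqAle M3_leE !M3_eqE. Qed.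

(* A lattice obtained by successive gluings of copies of M3, together with the
   map sending each element of M3 to its image in the last copy. *)
Record tower := Tower {
  tower_lat :> finLatticeType glue_display;
  last_copy : M3 -> tower_lat;
  last_copy_lt : forall a, M3_atom a -> last_copy a < last_copy M3delta;
  last_copy_filter : forall a, M3_atom a ->
    is_filter (pred2 (last_copy a) (last_copy M3delta))
}.

Definition M3_tower : tower :=
  @Tower M3 id M3_lt_delta M3_atom_filter.

Section Extend.
Variables (T : tower) (a b : M3) (aP : M3_atom a) (bP : M3_atom b).

Definition tower_filter2 : filter2 T :=
  Filter2 (last_copy_lt T aP) (last_copy_filter T aP).

Definition M3_ideal2 : ideal2 M3 :=
  Ideal2 (M3_eta_lt bP) (M3_atom_ideal bP).

Lemma extend_lt c : M3_atom c ->
  glueR tower_filter2 M3_ideal2 c < glueR tower_filter2 M3_ideal2 M3delta.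
Proof. by move=> cP; rewrite lt_leAnge !leq_glueR -lt_leAnge M3_lt_delta. Qed.

Lemma extend_filter c : M3_atom c ->
  is_filter (pred2 (glueR tower_filter2 M3_ideal2 c)
                   (glueR tower_filter2 M3_ideal2 M3delta)).
Proof.
by move=> cP; apply: glueR_filter2;
  [exact: M3_eta_lt | exact: M3_lt_delta | exact: M3_atom_filter].
Qed.

(* Glues the filter {a, delta} of the last copy to the ideal {eta, b} of a
   fresh copy of M3. *)
Definition extend : tower :=
  @Tower (glue tower_filter2 M3_ideal2) (glueR tower_filter2 M3_ideal2)
    extend_lt extend_filter.

End Extend.

Fact M3alpha_atom : M3_atom M3alpha. Proof. by rewrite /M3_atom !M3_eqE. Qed.
Fact M3gamma_atom : M3_atom M3gamma. Proof. by rewrite /M3_atom !M3_eqE. Qed.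

(* The indices start at 1; the value at 0 is irrelevant. *)
Fixpoint rod (n : nat) : tower :=
  match n with
  | 0 | 1 => M3_tower
  | m.+1 => extend (rod m) M3gamma_atom M3alpha_atom
  end.

Fixpoint snake (n : nat) : tower :=
  match n with
  | 0 | 1 => M3_tower
  | m.+1 => if odd m then extend (snake m) M3gamma_atom M3alpha_atom
            else extend (snake m) M3alpha_atom M3gamma_atom
  end.

(* Main.v *)
Require Import Defs.
From mathcomp Require Import all_boot all_order.
From HB Require Import structures.
From mathcomp Require Import boolp.
From Stdlib Require Import Relation_Operators.

(** Let [f0 : M3 -> Con A] be a sublattice of permuting congruences. On a
    [delta]-block modulo [eta], an element is determined by its [alpha]-class
    and its [gamma]-class, and these may be prescribed arbitrarily.

    Suppose a tower [T] is embedded in [Con B] so that the edge [a < delta] of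
    its last copy of M3 is the pullback of [f0 a < f0 delta] along a surjective
    homomorphism [g : B -> A]. In the subalgebra [B' = {(u, x) | g u delta x}]
    of [B * A], let [b] be another atom. The congruences [theta * f0 b] form a
    copy of [T]. Sending [(u, x)] to the point [p] with [g u a p] and [x b p]
    is a homomorphism [B' -> A / eta], along which [f0] pulls back to a new copy
    of M3. The upper edge [a < delta] of the former copy is the lower edge
    [eta < b] of the latter, so together they form the glued lattice. In the
    new copy both [a < delta] and [b < delta] are pulled back from [A], along
    [g u] and [x], so the construction can be iterated. *)

Set Implicit Arguments.
Unset Strict Implicit.
Unset Printing Implicit Defensive.

Import Order.TTheory.
Local Open Scope order_scope.

(** * Lattice embeddings *)

Section Embedding.
Variables (d d' : Order.disp_t) (L : latticeType d) (M : latticeType d').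
Implicit Types f : L -> M.

Definition lattice_embedding f : Prop :=
  [/\ {morph f : x y / x `&` y}, {morph f : x y / x `|` y} & injective f].

Lemma meet_morph_homo f : {morph f : x y / x `&` y} -> {homo f : x y / x <= y}.
Proof. by move=> fI x y /meet_idPl xy; apply/meet_idPl; rewrite -fI xy. Qed.

Lemma embedding_mono f : lattice_embedding f -> {mono f : x y / x <= y}.
Proof. by case=> fI _ f_inj x y; rewrite !leEmeet -fI (inj_eq f_inj). Qed.

Lemma sub_join_morph f : {morph f : x y / x `&` y} ->
  (forall x y, f (x `|` y) <= f x `|` f y) -> {morph f : x y / x `|` y}.
Proof.
move=> fI fU x y; apply: le_anti; rewrite fU leUx.
by rewrite !(meet_morph_homo fI) ?leUl ?leUr.
Qed.

Lemma lmorphism_of_embedding f : lattice_embedding f ->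
  exists h : {lmorphism L -> M}, h =1 f.
Proof.
case=> fI fU _.
pose fO := Order.isOrderMorphism.Build d L d' M f (meet_morph_homo fI).
pose fM := Order.isMeetLatticeMorphism.Build d L d' M f fI.
pose fJ := Order.isJoinLatticeMorphism.Build d L d' M f fU.
pose h : {lmorphism L -> M} := HB.pack f fO fM fJ.
by exists h.
Qed.

End Embedding.

Lemma Adm_embedding (sg : signature) (V : algebra sg -> Prop) (A : algebra sg)
    (d : Order.disp_t) (L : latticeType d) (f : L -> Con A) :
  V A -> lattice_embedding f -> Adm V L.
Proof.
move=> VA fE; exists A => //; have [h hf] := lmorphism_of_embedding fE.
have [_ _ f_inj] := fE.
by exists h => x y; rewrite !hf; apply: f_inj.
Qed.

(** * Embedding a glued lattice by two maps that agree on the shared edge *)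

Section GlueEmbedding.
Variables (d d' d'' : Order.disp_t).
Variables (P : finLatticeType d) (Q : finLatticeType d') (L : latticeType d'').
Variables (F : filter2 P) (I : ideal2 Q) (f : P -> L) (h : Q -> L).
Hypotheses (fE : lattice_embedding f) (hE : lattice_embedding h).
Hypotheses (eq_lo : f (flo F) = h (ilo I)) (eq_hi : f (fhi F) = h (ihi I)).

Definition glue_map (x : glue F I) : L :=
  match x with inl p => f p | inr q => h (val q) end.

Lemma glue_map_glueR q : glue_map (glueR F I q) = h q.
Proof. by case: (glueRP F I q) => [[-> ->]|[-> ->]|[u <- ->]]. Qed.

(** Every [f p] lies below [h (ihi I)] and every [h q] above [f (flo F)], so mixed meets and joins
    reduce to ones inside a single factor. *)
Lemma glue_map_embedding : lattice_embedding glue_map.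
Proof.
have [fI fU f_inj] := fE; have [hI hU h_inj] := hE.
have le_fh p : f p <= h (ihi I).
  by rewrite -eq_hi (embedding_mono fE) le_fhi.
have le_lo q : f (flo F) <= h q.
  by rewrite eq_lo (embedding_mono hE) ilo_le.
have meetE p q : f (if ihi I <= q then p else p `&` flo F) = f p `&` h q.
  case: ifP => Iq.
    apply/esym/meet_idPl; apply: le_trans (le_fh p) _.
    by rewrite (embedding_mono hE).
  (* As [f p] is below [h (ihi I)], only the meet of [ihi I] and [q] matters. It lies in the
     two-element ideal, and it is not [ihi I] because [ihi I <= q] fails. *)
  rewrite fI eq_lo -[in RHS](meet_idPl (le_fh p)) -meetA -hI; congr (_ `&` h _).
  have: ihi I `&` q \in pred2 (ilo I) (ihi I) by rewrite -le_ihi leIl.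
  rewrite !inE => /orP[]/eqP // Eq.
  by move: Iq; rewrite leEmeet Eq eqxx.
have joinE p q :
    h (if p <= flo F then q else q `|` ihi I) = f p `|` h q.
  case: ifP => pF.
    apply/esym/join_idPr; apply: le_trans (le_lo q).
    by rewrite (embedding_mono fE).
  rewrite hU -eq_hi -[in RHS](join_idPr (le_lo q)) joinA -fU joinC.
  congr (f _ `|` _).
  have: p `|` flo F \in pred2 (flo F) (fhi F) by rewrite -flo_le leUr.
  rewrite !inE => /orP[]/eqP // Eq.
  by move: pF; rewrite leEjoin Eq eqxx.
have lr p (q : {q : Q | q \notin pred2 (ilo I) (ihi I)}) : f p <> h (val q).
  move=> E; have := le_fh p.
  by rewrite E (embedding_mono hE) val_le_ihi.
split=> [x y|x y|].
- rewrite -[x `&` y]/(glue_meet x y); case: x y => [x|x] [y|y] /=.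
  + exact: fI.
  + exact: meetE.
  + by rewrite meetE meetC.
  + by rewrite glue_map_glueR hI.
- rewrite -[x `|` y]/(glue_join x y); case: x y => [x|x] [y|y] /=.
  + exact: fU.
  + by rewrite glue_map_glueR joinE.
  + by rewrite glue_map_glueR joinE joinC.
  + by rewrite glue_map_glueR hU.
- case=> [x|x] [y|y] /=.
  + by move/f_inj->.
  + by move/lr.
  + by move/esym/lr.
  + by move/h_inj/val_inj->.
Qed.

End GlueEmbedding.

(** * Congruences *)

Section Congruences.
Variables (sg : signature) (A : algebra sg).
Implicit Types r s : Con A.

Lemma con_leP r s : reflect (forall x y, r x y -> s x y) (r <= s).
Proof. exact: asboolP. Qed.

Lemma con_meetE r s x y : (r `&` s) x y <-> r x y /\ s x y.
Proof. by []. Qed.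

Definition join_clos r s : A -> A -> Prop :=
  clos_refl_trans A (fun x y => r x y \/ s x y).

(* A finitary operation is compatible with the closure because its arguments
   can be changed one at a time. *)
Lemma join_clos_op r s (o : symbol sg) (a b : 'I_(arity o) -> A) :
  (forall i, join_clos r s (a i) (b i)) -> join_clos r s (op a) (op b).
Proof.
move=> ab.
pose hyb k (i : 'I_(arity o)) := if (i < k)%N then b i else a i.
have stepP k : (k < arity o)%N -> join_clos r s (op (hyb k)) (op (hyb k.+1)).
  move=> lt_k; pose j := Ordinal lt_k.
  (* [hyb k] and [hyb k.+1] differ only at [j], so the chain from [a j] to [b j] can be pushed
     through the operation link by link. *)
  pose upd x (i : 'I_(arity o)) := if i == j then x else hyb k i.
  have -> : hyb k = upd (a j).
    apply/funext => i; rewrite /upd; case: eqP => [->|//].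
    by rewrite /hyb ltnn.
  have -> : hyb k.+1 = upd (b j).
    apply/funext => i; rewrite /upd /hyb ltnS.
    case: eqP => [->|]; first by rewrite leqnn.
    by move=> /eqP; rewrite -val_eqE /= ltn_neqAle => ->.
  elim: (ab j) => [x y xy|x|x y z _ xy _ yz]; first last.
  - exact: rt_trans xy yz.
  - exact: rt_refl.
  - apply: rt_step; case: xy => xy; [left|right]; apply: con_op => i;
    rewrite /upd; case: eqP => // _; exact: con_refl.
have hybP k : (k <= arity o)%N -> join_clos r s (op a) (op (hyb k)).
  elim: k => [_|k IHk lt_k]; first exact: rt_refl.
  exact: rt_trans (IHk (ltnW lt_k)) (stepP k lt_k).
have -> : b = hyb (arity o) by apply/funext => i; rewrite /hyb ltn_ord.
exact: hybP.
Qed.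

(** By [join_clos_op] the closure is itself a congruence, so it contains the impredicatively defined
    join. *)
Lemma con_joinE r s x y : (r `|` s) x y <-> join_clos r s x y.
Proof.
split=> [xy|].
  pose t := @Congruence sg A (join_clos r s).
  have sym u v : join_clos r s u v -> join_clos r s v u.
    elim=> {u v} [u v [uv|uv]|u|u v w _ vu _ wv].
    - by apply: rt_step; left; apply: con_sym.
    - by apply: rt_step; right; apply: con_sym.
    - exact: rt_refl.
    - exact: rt_trans wv vu.
  pose j := t (rt_refl _ _) sym (@rt_trans _ _) (@join_clos_op r s).
  by apply: (xy j) => u v uv; apply: rt_step; [left|right].
elim=> {x y} [x y [xy|xy]|x|x y z _ xy _ yz].
- by move=> t rt _; apply: rt.
- by move=> t _ st; apply: st.
- exact: con_refl.
- exact: con_trans xy yz.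
Qed.

(** Permutability makes the composite transitive: in [r], [s], [r], [s] the inner pair is
    swapped. *)
Lemma permute_join r s x y : permute r s -> (r `|` s) x y -> rel_comp r s x y.
Proof.
move=> rs /con_joinE; elim=> {x y} [x y [xy|xy]|x|x y z _ xy _ yz].
- by exists y => //; apply: con_refl.
- by exists x => //; apply: con_refl.
- by exists x; apply: con_refl.
- case: xy yz => u xu uy [v yv vz].
  have: rel_comp s r u v by exists y.
  rewrite -rs => -[w uw wv].
  by exists w; [apply: con_trans xu uw | apply: con_trans wv vz].
Qed.

End Congruences.

(** * Homomorphisms and congruences pulled back along them *)

Definition homomorphism (sg : signature) (B A : algebra sg) (g : B -> A) : Prop :=
  forall (o : symbol sg) (a : 'I_(arity o) -> B),
    g (op a) = op (fun i => g (a i)).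

Lemma hom_eval (sg : signature) (B A : algebra sg) (g : B -> A) :
  homomorphism g -> forall e t, g (eval e t) = eval (g \o e) t.
Proof.
move=> g_hom e; elim=> [//|o ts IHt] /=.
by rewrite g_hom; congr op; apply/funext.
Qed.

Definition comap (sg : signature) (B A : algebra sg) (g : B -> A)
    (g_hom : homomorphism g) (r : Con A) : Con B.
Proof.
refine (@Congruence sg B (fun u v => r (g u) (g v)) _ _ _ _).
- by move=> u; apply: con_refl.
- by move=> u v; apply: con_sym.
- by move=> u v w; apply: con_trans.
- by move=> o a b ab; rewrite !g_hom; apply: con_op.
Defined.

(* [R] plays the role of a homomorphism from [B] to a quotient of [A] lying
   above all congruences in the range of [f]. *)
Section Pullback.
Variables (sg : signature) (A B : algebra sg) (R : B -> A -> Prop).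
Hypothesis R_op : forall (o : symbol sg) a b,
  (forall i : 'I_(arity o), R (a i) (b i)) -> R (op a) (op b).
Hypothesis R_total : forall u, exists p, R u p.
Hypothesis R_surj : forall p, exists u, R u p.
Variables (d : Order.disp_t) (L : latticeType d) (f : L -> Con A).
Hypothesis R_fun : forall x u p q, R u p -> R u q -> f x p q.
Hypothesis fE : lattice_embedding f.

Definition pullback (x : L) : Con B.
Proof.
refine (@Congruence sg B (fun u v => forall p q, R u p -> R v q -> f x p q)
  _ _ _ _).
- by move=> u p q; apply: R_fun.
- by move=> u v uv p q Rp Rq; apply/con_sym/uv.
- move=> u v w uv vw p q Rp Rq; have [z Rz] := R_total v.
  by apply: con_trans (uv _ _ Rp Rz) (vw _ _ Rz Rq).
- move=> o a b ab p q Rp Rq.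
  (* [R_op] relates the value of the operation to its value at the chosen points, and [R_fun]
     compares the latter with the given [p] and [q]. *)
  have [p' Rp'] := choice (fun i => R_total (a i)).
  have [q' Rq'] := choice (fun i => R_total (b i)).
  apply: con_trans (R_fun x Rp (R_op Rp')) _.
  apply: con_trans (R_fun x (R_op Rq') Rq).
  by apply: con_op => i; apply: ab.
Defined.

Lemma pullbackE x u v p q : R u p -> R v q -> pullback x u v <-> f x p q.
Proof.
move=> Rp Rq; split=> [uv|pq p' q' Rp' Rq']; first exact: uv.
by apply: con_trans (R_fun x Rp' Rp) (con_trans pq (R_fun x Rq Rq')).
Qed.

(** Totality suffices for meets. Surjectivity lifts the intermediate points of a chain in [A], which
    settles joins, and also yields injectivity. *)
Lemma pullback_embedding : lattice_embedding pullback.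
Proof.
have [fI fU f_inj] := fE.
have pI : {morph pullback : x y / x `&` y}.
  move=> x y; apply: con_ext => u v; rewrite con_meetE.
  have [[p Rp] [q Rq]] := (R_total u, R_total v).
  by rewrite !(pullbackE _ Rp Rq) fI con_meetE.
split=> //.
  apply: (sub_join_morph pI) => x y; apply/con_leP => u v.
  have [[p Rp] [q Rq]] := (R_total u, R_total v).
  rewrite (pullbackE _ Rp Rq) fU => /con_joinE pq.
  elim: pq u v Rp Rq => {p q} [p q pq|p|p q z _ pq _ qz] u v Rp Rq.
  - case: pq => pq.
      by apply: (con_leP _ _ (leUl _ _)); rewrite (pullbackE _ Rp Rq).
    by apply: (con_leP _ _ (leUr _ _)); rewrite (pullbackE _ Rp Rq).
  - apply: (con_leP _ _ (leUl _ _)); rewrite (pullbackE _ Rp Rq).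
    exact: con_refl.
  - have [w Rw] := R_surj q.
    by apply: con_trans (pq _ _ Rp Rw) (qz _ _ Rw Rq).
move=> x y xy; apply: f_inj; apply: con_ext => p q.
have [[u Ru] [v Rv]] := (R_surj p, R_surj q).
by rewrite -(pullbackE _ Ru Rv) xy (pullbackE _ Ru Rv).
Qed.

End Pullback.

(** * Extending a tower *)

Section Fiber.
Variables (sg : signature) (B A : algebra sg) (g : B -> A) (s : Con A).
Hypothesis g_hom : homomorphism g.

(** The fibre product of [B] and [A] over the quotient of [A] by [s]. *)
Definition fiber_type : Type := {u : B * A | s (g u.1) u.2}.

Definition fiber_pair u x (ux : s (g u) x) : fiber_type :=
  exist (fun u : B * A => s (g u.1) u.2) (u, x) ux.

Lemma fiber_op_subproof (o : symbol sg) (a : 'I_(arity o) -> fiber_type) :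
  s (g (op (fun i => (sval (a i)).1))) (op (fun i => (sval (a i)).2)).
Proof. by rewrite g_hom; apply: con_op => i; apply: (svalP (a i)). Qed.

Lemma fiber_nonempty : inhabited fiber_type.
Proof.
by have [u] := carrier_nonempty B; constructor; exists (u, g u); apply: con_refl.
Qed.

Definition fiber : algebra sg :=
  Algebra fiber_nonempty (fun o a => fiber_pair (fiber_op_subproof a)).

Definition fiber1 (u : fiber) : B := (sval u).1.
Definition fiber2 (u : fiber) : A := (sval u).2.

Lemma fiber1_hom : homomorphism fiber1. Proof. by []. Qed.
Lemma fiber2_hom : homomorphism fiber2. Proof. by []. Qed.

Lemma fiberP (u : fiber) : s (g (fiber1 u)) (fiber2 u).
Proof. exact: svalP u. Qed.

Lemma fiber_inj (u v : fiber) :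
  fiber1 u = fiber1 v -> fiber2 u = fiber2 v -> u = v.
Proof.
case: u v => [[u x] ux] [[v y] vy]; rewrite /fiber1 /fiber2 /= => uv xy.
by case: _ / uv vy; case: _ / xy => vy; congr exist; apply: Prop_irrelevance.
Qed.

(** The two projections are jointly injective homomorphisms, so an identity can be checked in each
    factor. *)
Lemma fiber_variety (V : algebra sg -> Prop) :
  variety V -> V B -> V A -> V fiber.
Proof.
case=> E VE /VE BE /VE AE; apply/VE => t1 t2 t12 e; apply: fiber_inj.
  by rewrite !(hom_eval fiber1_hom); apply: BE.
by rewrite !(hom_eval fiber2_hom); apply: AE.
Qed.

End Fiber.

(** * Towers realized by congruences whose last edges are pulled back from [A] *)

Section Realization.
Variables (sg : signature) (A : algebra sg) (f0 : M3 -> Con A).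

Definition edge_pullback (T : tower) (B : algebra sg) (f : T -> Con B) (t : M3) :
    Prop :=
  exists g : B -> A,
    [/\ homomorphism g, forall p, exists u, g u = p,
        forall u v, f (last_copy T t) u v <-> f0 t (g u) (g v) &
        forall u v, f (last_copy T M3delta) u v <-> f0 M3delta (g u) (g v)].

Variables (V : algebra sg -> Prop) (hV : variety V) (VA : V A).
Hypotheses (f0E : lattice_embedding f0) (f0_perm : forall x y, permute (f0 x) (f0 y)).

(** Two atoms are tracked because, after a gluing of edge [a] to edge [b], a rod continues along [a]
    and a snake along [b]. The two maps to [A] may differ. *)
Definition realizable (T : tower) (a b : M3) : Prop :=
  exists2 B : algebra sg, V B & exists f : T -> Con B,
    [/\ lattice_embedding f, edge_pullback f a & edge_pullback f b].

Lemma realizable_sym T a b : realizable T a b -> realizable T b a.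
Proof. by case=> B VB [f [fE fa fb]]; exists B => //; exists f. Qed.

Lemma realizable_M3 a b : realizable M3_tower a b.
Proof.
by exists A => //; exists f0; split=> //; exists id; split=> // p; exists p.
Qed.

Lemma M3_le_delta (x : M3) : x <= M3delta.
Proof. by rewrite M3_leE eqxx !orbT. Qed.

Lemma M3_eta_le (x : M3) : M3eta <= x.
Proof. by rewrite M3_leE eqxx !orbT. Qed.

Lemma M3_atom_meet (a b : M3) : M3_atom a -> M3_atom b -> a != b ->
  a `&` b = M3eta.
Proof.
rewrite -[a `&` b]/(M3_meet a b) /M3_meet /M3_le /M3_atom.
by case: a; case: b; rewrite !M3_eqE.
Qed.

Lemma M3_atom_join (a b : M3) : M3_atom a -> M3_atom b -> a != b ->
  a `|` b = M3delta.
Proof.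
rewrite -[a `|` b]/(M3_join a b) /M3_join /M3_le /M3_atom.
by case: a; case: b; rewrite !M3_eqE.
Qed.

Lemma realizable_extend (T : tower) (a b c : M3) (aP : M3_atom a)
    (bP : M3_atom b) : a != b -> realizable T a c ->
  realizable (extend T aP bP) a b.
Proof.
move=> ab [B VB [f [fE [g [g_hom g_surj fa fd]] _]]].
have [f0I f0U f0_inj] := f0E; have [fI fU f_inj] := fE.
have f0_le x y : x <= y -> forall p q, f0 x p q -> f0 y p q.
  by move=> xy; apply/con_leP; rewrite (embedding_mono f0E).
have le_last p : p <= last_copy T M3delta := le_fhi (tower_filter2 T aP) p.
pose B' := fiber (f0 M3delta) g_hom.
pose pr1 : B' -> B := @fiber1 _ _ _ _ _ g_hom.
pose pr2 : B' -> A := @fiber2 _ _ _ _ _ g_hom.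
have pr1_hom : homomorphism pr1 by apply: fiber1_hom.
have pr2_hom : homomorphism pr2 by apply: fiber2_hom.
have B'P u : f0 M3delta (g (pr1 u)) (pr2 u) by apply: fiberP.
pose mk u x (ux : f0 M3delta (g u) x) : B' := fiber_pair ux.
have eta_pq p q : f0 M3eta p q <-> f0 a p q /\ f0 b p q.
  by rewrite -con_meetE -f0I M3_atom_meet.
pose R (u : B') p := f0 a (g (pr1 u)) p /\ f0 b (pr2 u) p.
have R_op (o : symbol sg) (u : 'I_(arity o) -> B') p :
    (forall i, R (u i) (p i)) -> R (op u) (op p).
  move=> up; split; rewrite ?pr1_hom ?pr2_hom ?g_hom;
    by apply: con_op => i; have [] := up i.
(* Permutability enters here: [delta] is the join of [a] and [b], so one [a]-step followed by one
   [b]-step reaches [pr2 u]. *)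
have R_total u : exists p, R u p.
  have: f0 M3delta (g (pr1 u)) (pr2 u) by [].
  rewrite -(M3_atom_join aP bP ab) f0U => /(permute_join (f0_perm _ _))[p ap pb].
  by exists p; split=> //; apply: con_sym.
have R_surj p : exists u, R u p.
  have [u up] := g_surj p.
  have up' : f0 M3delta (g u) p by rewrite up; apply: con_refl.
  by exists (mk _ _ up'); split; rewrite /pr1 /pr2 /fiber1 /fiber2 /= ?up;
    apply: con_refl.
have R_fun x u p q : R u p -> R u q -> f0 x p q.
  case=> ap bp [aq bq]; apply: (f0_le _ _ (M3_eta_le x)); apply/eta_pq.
  by split; [apply: con_trans aq | apply: con_trans bq]; apply: con_sym.
pose h : M3 -> Con B' := pullback R_op R_total R_fun.
have hE : lattice_embedding h by apply: pullback_embedding.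
(* Passing from [g (pr1 u)] to [p] is an [a]-step, absorbed by any [x] above [a]. *)
have RE1 x u v p q : a <= x -> R u p -> R v q ->
    f0 x (g (pr1 u)) (g (pr1 v)) <-> f0 x p q.
  move=> /f0_le ax [/ax up _] [/ax vq _]; split=> uv.
    by apply: con_trans vq; apply: con_trans uv; apply: con_sym.
  by apply: con_trans (con_sym vq); apply: con_trans uv.
have RE2 x u v p q : b <= x -> R u p -> R v q ->
    f0 x (pr2 u) (pr2 v) <-> f0 x p q.
  move=> /f0_le bx [_ /bx up] [_ /bx vq]; split=> uv.
    by apply: con_trans vq; apply: con_trans uv; apply: con_sym.
  by apply: con_trans (con_sym vq); apply: con_trans uv.
have h1 x u v : a <= x -> h x u v <-> f0 x (g (pr1 u)) (g (pr1 v)).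
  move=> ax; have [[p Rp] [q Rq]] := (R_total u, R_total v).
  by rewrite (RE1 x u v p q) //; apply: pullbackE.
have h2 x u v : b <= x -> h x u v <-> f0 x (pr2 u) (pr2 v).
  move=> bx; have [[p Rp] [q Rq]] := (R_total u, R_total v).
  by rewrite (RE2 x u v p q) //; apply: pullbackE.
pose k (p : T) : Con B' := comap pr1_hom (f p) `&` comap pr2_hom (f0 b).
have kP p u v : k p u v <-> f p (pr1 u) (pr1 v) /\ f0 b (pr2 u) (pr2 v) by [].
(* [f p] lies below the top of the last copy, so moving along it keeps the image under [g] in the
   same [delta]-block. *)
have lift p u v x : f p u v -> f0 M3delta (g u) x -> f0 M3delta (g v) x.
  move=> uv ux; apply: con_trans ux; apply: con_sym; apply/fd.
  by move: uv; apply/con_leP; rewrite (embedding_mono fE).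
have kI : {morph k : p q / p `&` q}.
  move=> p q; apply: con_ext => u v.
  by rewrite con_meetE !kP fI con_meetE; split=> [[[? ?] ?]|[[? ?] [? ?]]].
(* The chain in [B] is lifted with second coordinate fixed at [x]; only the last link moves it to
   [y]. *)
have kU p q u v : join_clos (f p) (f q) u v -> forall x y ux vy, f0 b x y ->
    (k p `|` k q) (mk u x ux) (mk v y vy).
  elim=> {u v} [u v uv|u|u w v uw IHu _ IHw] x y ux vy xy.
  - case: uv => uv; first by apply: (con_leP _ _ (leUl (k p) (k q))).
    by apply: (con_leP _ _ (leUr (k q) (k p))).
  - apply: (con_leP _ _ (leUl (k p) (k q))); apply/kP.
    by split=> //; apply: con_refl.
  - have wx : f0 M3delta (g w) x.
      by apply: (lift (p `|` q)) ux; rewrite fU; apply/con_joinE.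
    exact: con_trans (IHu x x ux wx (con_refl _ _)) (IHw x y wx vy xy).
have kE : lattice_embedding k.
  split=> //.
    apply: (sub_join_morph kI) => p q; apply/con_leP => u v /kP[].
    rewrite fU => /con_joinE.
    case: u v => [[u x] ux] [[v y] vy] uv xy.
    exact: (kU p q u v uv x y ux vy xy).
  (* [k p] is tested on pairs with the common second coordinate [g u], where the condition on [f0 b]
     is trivial. *)
  have k_sub p q : k p = k q -> forall u v, f p u v -> f q u v.
    move=> pq u v uv; have uu := con_refl (f0 M3delta) (g u).
    have: k p (mk u _ uu) (mk v _ (lift _ _ _ _ uv uu)).
      by apply/kP; split=> //; apply: con_refl.
    by rewrite pq => /kP[].
  by move=> p q pq; apply: f_inj; apply: con_ext => u v; split; apply: k_sub.
have k_lo : k (last_copy T a) = h M3eta.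
  apply: con_ext => u v; have [[p Rp] [q Rq]] := (R_total u, R_total v).
  rewrite kP fa (RE1 a u v p q) // (RE2 b u v p q) // -eta_pq.
  by apply: iff_sym; apply: pullbackE.
(* Within [B'] the second condition implies the first, since [b] is below [delta]. *)
have k_hi : k (last_copy T M3delta) = h b.
  apply: con_ext => u v; rewrite kP fd h2 //; split=> [[]|uv] //; split=> //.
  apply: con_trans (B'P u) _; apply: con_trans (con_sym (B'P v)).
  exact: f0_le (M3_le_delta b) _ _ uv.
exists B'; first exact: fiber_variety.
exists (glue_map (F := tower_filter2 T aP) (I := M3_ideal2 bP) k h); split.
- exact: glue_map_embedding.
- exists (g \o pr1); split=> [o u|p|u v|u v]; first by rewrite /= pr1_hom g_hom.
  + have [u up] := g_surj p; exists (mk _ _ (con_refl (f0 M3delta) (g u))).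
    exact: up.
  + by rewrite glue_map_glueR // h1.
  + by rewrite glue_map_glueR // h1 ?M3_le_delta.
- exists pr2; split=> // [p|u v|u v].
  + have [u up] := g_surj p; rewrite -up.
    by exists (mk _ _ (con_refl (f0 M3delta) (g u))).
  + by rewrite glue_map_glueR // h2.
  + by rewrite glue_map_glueR // h2 ?M3_le_delta.
Qed.

End Realization.

Theorem theorem1p4 (sg : signature) (V : algebra sg -> Prop)
  (hV : variety V)
  (hM3 : exists2 A : algebra sg, V A &
     exists f : {lmorphism M3 -> Con A},
       injective f /\ forall x y : M3, permute (f x) (f y)) :
  forall n : nat, (1 <= n)%N -> Adm V (rod n) /\ Adm V (snake n).
Proof.
case: hM3 => A VA [f [f_inj f_perm]] n n_gt0.
have fE : lattice_embedding f by split=> //; [apply: omorphI | apply: omorphU].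
have ac : M3alpha != M3gamma by rewrite M3_eqE.
have ca : M3gamma != M3alpha by rewrite M3_eqE.
have AdmT T a b : realizable f V T a b -> Adm V T.
  by case=> B VB [h [hE _ _]]; apply: Adm_embedding hE.
split.
  apply: (AdmT _ M3gamma M3alpha).
  case: n n_gt0 => // n _; elim: n => [|n IHn]; first exact: realizable_M3.
  exact: realizable_extend IHn.
apply: (AdmT _ M3gamma M3alpha).
case: n n_gt0 => // n _; elim: n => [|n IHn]; first exact: realizable_M3.
rewrite /=; case: ifP => _; first exact: realizable_extend IHn.
(* In this case the gluing is along [alpha], so the two atoms are exchanged before and after it. *)
by apply/realizable_sym/realizable_extend; rewrite //; apply: realizable_sym IHn.
Qed.
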